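(* (Relations between $\Xi$ and $\Phi$.) For any composition $I$, in $\mathcal NSym$ we have $$\Phi^I=(-1)^{\ell(I)}\sum_{J\succeq I}\Big(\sum_{J\succeq L\succeq I}\frac{(-1)^{\ell(L)}\,\pi(I)}{\pi_u(\bar J,\bar L)\,\ell(L,I)}\Big)\Xi^J,$$ $$\Xi^I=(-1)^{\ell(I)}\sum_{J\succeq I}\Big(\sum_{J\succeq L\succeq I}\frac{(-1)^{\ell(L)}\,fp(L,I)}{sp(J,L)}\Big)\Phi^J,$$ where $J$ and $L$ range over compositions.
   Context: $K$ is a unital commutative $\mathbb Q$-algebra and $t$ a central formal parameter. $\mathcal NSym$ is the free unital associative $K$-algebra on noncommuting variables $\Lambda_m$ ($m\ge1$), $\Lambda_0=1$, $\lambda(t)=\sum_{m\ge0}t^m\Lambda_m$. Elements $S_m,\Phi_m,\Xi_m$ of $\mathcal NSym$ are defined by $\sigma(t)=\sum_{m\ge0}t^mS_m$, $\Phi(t)=\sum_{m\ge1}t^m\Phi_m/m$, $\xi(t)=\sum_{m\ge1}t^{m-1}\Xi_m$, the unique solutions in $\mathcal NSym[[t]]$ of $\lambda(-t)\sigma(t)=\sigma(t)\lambda(-t)=1$, $e^{\Phi(t)}=\sigma(t)$, $\frac{d\sigma(t)}{dt}=\xi(t)\sigma(t)$. A composition is a nonempty finite sequence $I=(i_1,\dots,i_m)$ of positive integers; $\ell(I)=m$, $|I|=\sum i_j$, $\bar I=(i_m,\dots,i_1)$. For a sequence $w=\{w_k\}$, $w^I=w_{i_1}\cdots w_{i_m}$.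 $fp(I)=i_1$, $\pi(I)=\prod_ji_j$, $\pi_u(I)=\prod_{j=1}^m(i_1+\cdots+i_j)$, $sp(I)=\ell(I)!\,\pi(I)$. $J\succeq I$ means $J$ is a refinement of $I$: $J$ is the concatenation $J_1\cdot J_2\cdots J_m$ of compositions $J_a$ with $|J_a|=i_a$; then $\ell(J,I)=\prod_a\ell(J_a)$, $\pi_u(J,I)=\prod_a\pi_u(J_a)$, $sp(J,I)=\prod_asp(J_a)$, $fp(J,I)=\prod_afp(J_a)$. *)

(* Defs.v *)
From mathcomp Require Import all_boot all_order all_algebra.
From mathcomp Require Export monalg.

Set Implicit Arguments.
Unset Strict Implicit.
Unset Printing Implicit Defensive.

Import GRing.Theory.
Local Open Scope ring_scope.

(** * Compositions *)

Definition is_comp (I : seq nat) : bool := (I != [::]) && all (leq 1) I.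

(* Compositions of n.+2 from those of n.+1: prepend a part 1, or increment the
   first part. There is no composition of 0, since the empty sequence is
   excluded. *)
Fixpoint compositions (n : nat) : seq (seq nat) :=
  if n isn't n'.+1 then [::] else
  if n' is 0 then [:: [:: 1%N]] else
  [seq 1%N :: c | c <- compositions n'] ++
  [seq (head 0%N c).+1 :: behead c | c <- compositions n'].

Lemma mem_compositions n c :
  (c \in compositions n) = is_comp c && (sumn c == n).
Proof.
elim: n c => [|[|n] IHn] c.
- by rewrite in_nil; case: c => [|[|i] c] //=; rewrite andbF.
- rewrite /= inE /is_comp; case: c => [|[|[|i]] [|[|j] c]] //=;
    by rewrite ?andbF // addSn eqSS addnC addSn andbF.
have -> : compositions n.+2 = [seq 1%N :: c | c <- compositions n.+1] ++
  [seq (head 0%N c).+1 :: behead c | c <- compositions n.+1] by [].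
rewrite mem_cat; apply/orP/idP => [[]|].
- case/mapP => d; rewrite IHn => /andP[/andP[_ d_gt0] /eqP def_n] ->.
  by rewrite /is_comp /= d_gt0 def_n add1n eqxx.
- case/mapP => d; rewrite IHn => /andP[/andP[d0 d_gt0] /eqP def_n] ->.
  by case: d d0 d_gt0 def_n => //= i d _ /andP[_ dP] <-; rewrite /is_comp /= dP /=.
case: c => [|[|[|i]] c] //.
- rewrite /is_comp /= add1n eqSS => /andP[c_gt0 /eqP sc]; left.
  apply: map_f; rewrite IHn sc eqxx andbT /is_comp c_gt0 andbT.
  by case: c {c_gt0} sc.
- rewrite /is_comp /= addSn eqSS => /andP[c_gt0 /eqP sc]; right.
  apply/mapP; exists (i.+1 :: c) => //.
  by rewrite IHn /is_comp /= c_gt0 sc eqxx.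
Qed.

Lemma compositions_uniq n : uniq (compositions n).
Proof.
elim: n => [|[|n] IHn] //.
have -> : compositions n.+2 = [seq 1%N :: c | c <- compositions n.+1] ++
  [seq (head 0%N c).+1 :: behead c | c <- compositions n.+1] by [].
rewrite cat_uniq map_inj_uniq ?IHn => [|x y [] //].
apply/andP; split => //; apply/andP; split.
  apply/hasPn => _ /mapP[d + ->]; rewrite mem_compositions => /andP[dP _].
  apply/mapP => -[e _ []]; case: d dP => // i d.
  by rewrite /is_comp /= => /andP[i_gt0 _] ei; rewrite ei in i_gt0.
rewrite map_inj_in_uniq // => x y; rewrite !mem_compositions.
by case: x y => [|i x] [|j y] // _ _ [-> ->].
Qed.

(** * Refinements *)

(* The greedy cutting of J into consecutive blocks, the a-th one being the
   shortest prefix of what remains of J whose sum reaches the a-th part of I. *)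
Fixpoint blocks (J I : seq nat) : seq (seq nat) :=
  if I is i :: I' then
    let k := find (fun k => i <= sumn (take k J))%N (iota 0 (size J).+1) in
    take k J :: blocks (drop k J) I'
  else [::].

(* refines J I is the relation "J is a refinement of I", see [refinesP]. *)
Definition refines (J I : seq nat) : bool :=
  [&& flatten (blocks J I) == J, map sumn (blocks J I) == I
    & all is_comp (blocks J I)].

Lemma blocks_flatten (Js : seq (seq nat)) :
  all is_comp Js -> blocks (flatten Js) (map sumn Js) = Js.
Proof.
elim: Js => // J Js IHJs /andP[/andP[_ J_gt0] JsP].
pose k := find (fun k => sumn J <= sumn (take k (J ++ flatten Js)))%N
  (iota 0 (size (J ++ flatten Js)).+1).
have -> : blocks (flatten (J :: Js)) (map sumn (J :: Js)) =
  take k (J ++ flatten Js) :: blocks (drop k (J ++ flatten Js)) (map sumn Js).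
  by [].
suff -> : k = size J by rewrite take_size_cat // drop_size_cat // IHJs.
have take_lt m : (m < size J)%N -> (sumn (take m J) < sumn J)%N.
  elim: J J_gt0 m {k} => //= i J IHJ /andP[i_gt0 J_gt0] [|m] /=.
    by rewrite addn_gt0 i_gt0.
  by rewrite ltnS ltn_add2l; apply: IHJ.
pose s := iota 0 (size (J ++ flatten Js)).+1.
have sz : (size J < size s)%N by rewrite size_iota size_cat ltnS leq_addr.
have nths m : (m <= size J)%N -> nth 0%N s m = m.
  move=> mJ; rewrite nth_iota ?add0n // ltnS (leq_trans mJ) //.
  by rewrite size_cat leq_addr.
apply/eqP; rewrite eqn_leq; apply/andP; split; rewrite leqNgt; apply/negP => lt.
- move: (before_find 0%N lt); rewrite nths //.
  by rewrite take_size_cat // leqnn.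
have hs : has (fun k => sumn J <= sumn (take k (J ++ flatten Js)))%N s.
  by rewrite has_find (ltn_trans lt).
have := nth_find 0%N hs; rewrite -/k nths ?(ltnW lt) //.
by rewrite takel_cat ?(ltnW lt) // leqNgt take_lt.
Qed.

Lemma refinesP (J I : seq nat) :
  reflect (exists Js, [/\ flatten Js = J, map sumn Js = I & all is_comp Js])
          (refines J I).
Proof.
apply: (iffP and3P) => [[/eqP ? /eqP ? ?]|]; first by exists (blocks J I).
by case=> Js [<- <- JsP]; rewrite blocks_flatten.
Qed.

(** * Statistics on compositions *)

Definition fp (I : seq nat) : nat := head 0%N I.
Definition pi_comp (I : seq nat) : nat := (\prod_(i <- I) i)%N.
Definition pi_u (I : seq nat) : nat :=
  (\prod_(j < size I) sumn (take j.+1 I))%N.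
Definition sp (I : seq nat) : nat := ((size I)`! * pi_comp I)%N.

(* f(J,I) = \prod_a f(J_a), where J = J_1 ... J_m and |J_a| = i_a; meaningful
   when refines J I holds. *)
Definition relprod (f : seq nat -> nat) (J I : seq nat) : nat :=
  (\prod_(B <- blocks J I) f B)%N.

(** * Formal power series in a central variable *)

(* A series over a noncommutative ring, given by its coefficients. *)
Definition fps (A : Type) := nat -> A.

Definition fps1 (A : nzRingType) : fps A := fun n => (n == 0)%:R.

Definition fps_mul (A : nzRingType) (f g : fps A) : fps A :=
  fun n => \sum_(i < n.+1) f i * g (n - i)%N.

Definition fps_pow (A : nzRingType) (f : fps A) (k : nat) : fps A :=
  iter k (fps_mul f) (fps1 A).

Definition fps_deriv (A : nzRingType) (f : fps A) : fps A :=
  fun n => f n.+1 *+ n.+1.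

Definition fps_mirror (A : nzRingType) (f : fps A) : fps A :=
  fun n => (-1) ^+ n * f n.

(* exp(f) = \sum_k f^k / k!, for f with no constant term: then f^k does not
   contribute to the coefficient of t^n when k > n. *)
Definition fps_exp (K : comAlgType rat) (A : lalgType K) (f : fps A) : fps A :=
  fun n => \sum_(k < n.+1) (k`!%:R^-1 : rat)%:A *: fps_pow f k n.

(** * Noncommutative symmetric functions *)

(* The free associative algebra on Lambda_1, Lambda_2, ..., as the algebra of
   the free monoid on nat; the letter m : nat stands for Lambda_(m.+1). *)
Definition NSym (K : comAlgType rat) := {malg K[{fmonom nat}]}.

Definition Lambda (K : comAlgType rat) (m : nat) : NSym K :=
  if m is m'.+1 then << fmu m' >> else 1.

Section Series.
Variables (K : comAlgType rat) (S Phi Xi : nat -> NSym K).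

Definition lambda_series : fps (NSym K) := fun m => Lambda K m.
Definition sigma_series : fps (NSym K) := fun m => S m.
Definition Phi_series : fps (NSym K) :=
  fun m => if m == 0%N then 0 else (m%:R^-1 : rat)%:A *: Phi m.
Definition xi_series : fps (NSym K) := fun m => Xi m.+1.

End Series.

(* w^I, the product being taken from left to right *)
Definition wpow (K : comAlgType rat) (w : nat -> NSym K) (I : seq nat) :
  NSym K := \prod_(i <- I) w i.

(** * Existence of the defining families *)

Section Existence.

Lemma causal_fix (A : zmodType) (F : (nat -> A) -> nat -> A) :
    (forall f g n, (forall i, (i < n)%N -> f i = g i) -> F f n = F g n) ->
  exists f, f =1 F f.
Proof.
move=> Fc; pose h m := iter m F (fun=> 0).
have hE n : forall m p, (n < m)%N -> (n < p)%N -> h m n = h p n.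
  elim/ltn_ind: n => n IHn [|m] [|p] //; rewrite !ltnS => nm np.
  by apply: Fc => i lt_in; apply: IHn => //; apply: leq_trans lt_in _.
exists (fun n => h n.+1 n) => n.
transitivity (F (h n) n); first by [].
by apply: Fc => i lt_in; apply: (hE i n i.+1).
Qed.

Variable A : nzRingType.
Implicit Types f g h : fps A.

Lemma fps_mul_poly f g N n : (n < N)%N ->
  fps_mul f g n = ((\poly_(i < N) f i) * (\poly_(i < N) g i))`_n.
Proof.
move=> nN; rewrite coefM; apply: eq_bigr => i _; rewrite !coef_poly.
have iN : (i < N)%N by apply: leq_ltn_trans nN; rewrite -ltnS.
by rewrite iN (leq_ltn_trans (leq_subr _ _) nN).
Qed.

Lemma fps_mulA f g h : fps_mul f (fps_mul g h) =1 fps_mul (fps_mul f g) h.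
Proof.
move=> n; pose p f := \poly_(i < n.+1) f i : {poly A}.
transitivity ((p f * (p g * p h))`_n).
  rewrite coefM; apply: eq_bigr => i _; rewrite coef_poly ltn_ord.
  by rewrite -fps_mul_poly // ltnS leq_subr.
rewrite mulrA coefM; apply: eq_bigr => i _.
by rewrite [(p h)`__]coef_poly ltnS leq_subr -fps_mul_poly.
Qed.

Lemma eq_fps_mul f f' g g' :
  f =1 f' -> g =1 g' -> fps_mul f g =1 fps_mul f' g'.
Proof. by move=> ef eg n; apply: eq_bigr => i _; rewrite ef eg. Qed.

Lemma fps_mul1 f : fps_mul f (fps1 A) =1 f.
Proof.
move=> n; rewrite /fps_mul big_ord_recr /= subnn mulr1 big1 ?add0r // => i _.
by rewrite /fps1 subn_eq0 leqNgt ltn_ord mulr0.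
Qed.

Lemma fps_1mul f : fps_mul (fps1 A) f =1 f.
Proof.
move=> n; rewrite /fps_mul big_ord_recl /= subn0 mul1r big1 ?addr0 // => i _.
by rewrite mul0r.
Qed.

Lemma fps_inv_exists f : f 0%N = 1 ->
  exists g, fps_mul f g =1 fps1 A /\ fps_mul g f =1 fps1 A.
Proof.
move=> f0.
have [|g gE] := @causal_fix A (fun g n =>
    if n is n'.+1 then - \sum_(i < n) f i.+1 * g (n' - i)%N else 1).
- move=> g h [|n] // eq_gh; congr (- _); apply: eq_bigr => i _.
  by rewrite eq_gh // ltnS leq_subr.
have [|h hE] := @causal_fix A (fun g n =>
    if n is n'.+1 then - \sum_(i < n) g i * f (n - i)%N else 1).
- move=> g' h [|n] // eq_gh; congr (- _); apply: eq_bigr => i _.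
  by rewrite eq_gh.
have fg : fps_mul f g =1 fps1 A.
  case=> [|n]; first by rewrite /fps_mul big_ord1 f0 gE mulr1.
  by rewrite /fps_mul big_ord_recl f0 mul1r subn0 gE addNr.
have hf : fps_mul h f =1 fps1 A.
  case=> [|n]; first by rewrite /fps_mul big_ord1 f0 hE mulr1.
  by rewrite /fps_mul big_ord_recr /= subnn f0 mulr1 hE addrN.
exists g; split=> // n; rewrite -hf; apply: eq_fps_mul => // {}n.
rewrite -[LHS]fps_1mul -(eq_fps_mul hf (frefl g)) -fps_mulA.
by rewrite (eq_fps_mul (frefl h) fg) fps_mul1.
Qed.

End Existence.

Section ExistenceExp.
Variables (K : comAlgType rat) (A : lalgType K).
Implicit Types f g s : fps A.

Lemma eq_fps_pow f g n k : (forall i, (i < n)%N -> f i = g i) ->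
  forall m, (m < n)%N -> fps_pow f k m = fps_pow g k m.
Proof.
move=> eq_fg; elim: k => // k IHk m mn; apply: eq_bigr => i _.
rewrite eq_fg; last by apply: leq_ltn_trans mn; rewrite -ltnS.
by congr (_ * _); apply: IHk; apply: leq_ltn_trans mn; apply: leq_subr.
Qed.

Lemma fps_exp_top f g n : f 0%N = 0 ->
    (forall i, (i < n.+1)%N -> f i = g i) -> g n.+1 = 0 ->
  fps_exp f n.+1 = f n.+1 + fps_exp g n.+1.
Proof.
move=> f0 eq_fg gn.
have g0 : g 0%N = 0 by rewrite -eq_fg.
have pow0 h k : h 0%N = 0 -> fps_pow h k.+1 0%N = 0.
  by move=> h0; rewrite /fps_pow /= /fps_mul big_ord1 h0 mul0r.
rewrite /fps_exp big_ord_recl [in RHS]big_ord_recl /= addrCA; congr (_ + _).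
rewrite big_ord_recl [in RHS]big_ord_recl /= addrA.
rewrite !fps_mul1 gn scaler0 addr0 invr1 !scale1r; congr (_ + _).
apply: eq_bigr => k _; congr (_ *: _).
change (fps_mul f (fps_pow f k.+1) n.+1 = fps_mul g (fps_pow g k.+1) n.+1).
rewrite /fps_mul.
rewrite big_ord_recl f0 [in RHS]big_ord_recl g0 !mul0r; congr (_ + _).
rewrite big_ord_recr [in RHS]big_ord_recr.
rewrite (_ : (n.+1 - lift ord0 ord_max)%N = 0%N); last by rewrite lift0 subnn.
rewrite !pow0 // !mulr0; congr (_ + _); apply: eq_bigr => i _.
rewrite !lift0 eq_fg ?ltnS //=; congr (_ * _).
by apply: (@eq_fps_pow f g n.+1 k.+1) => //; rewrite ltnS subSS leq_subr.
Qed.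

Lemma fps_log_exists s : s 0%N = 1 ->
  exists f, f 0%N = 0 /\ fps_exp f =1 s.
Proof.
move=> s0.
pose tr n f : fps A := fun i => if (0 < i < n)%N then f i else 0.
have [|f fE] := @causal_fix A (fun f n =>
    if n == 0%N then 0 else s n - fps_exp (tr n f) n).
  move=> f g n eq_fg; case: eqP => // _; congr (_ - _).
  apply: eq_bigr => k _; congr (_ *: _).
  apply: (eq_fps_pow (n := n.+1)) => // i _; rewrite /tr.
  by case: ifP => // /andP[_ /eq_fg].
have f0 : f 0%N = 0 by rewrite fE.
exists f; split=> // -[|n].
  by rewrite /fps_exp big_ord1 /= invr1 !scale1r s0.
rewrite (@fps_exp_top f (tr n.+1 f)) //.
- by rewrite fE /= subrK.
- by move=> [|i] lt_in; rewrite /tr ?f0 //= lt_in.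
- by rewrite /tr ltnn andbF.
Qed.

End ExistenceExp.

Lemma families_exist (K : comAlgType rat) :
  exists S Phi Xi : nat -> NSym K,
  [/\ fps_mul (fps_mirror (lambda_series K)) (sigma_series S) =1 fps1 (NSym K),
      fps_mul (sigma_series S) (fps_mirror (lambda_series K)) =1 fps1 (NSym K),
      fps_exp (Phi_series Phi) =1 sigma_series S
    & fps_deriv (sigma_series S) =1
        fps_mul (xi_series Xi) (sigma_series S)].
Proof.
have l0 : fps_mirror (lambda_series K) 0%N = 1 by rewrite /fps_mirror mul1r.
have [S [lS Sl]] := fps_inv_exists l0.
have S0 : S 0%N = 1.
  by move: (lS 0%N); rewrite /fps_mul big_ord1 l0 mul1r.
have [T [_ TS]] := fps_inv_exists S0.
have [f [f0 fS]] := @fps_log_exists K (NSym K) S S0.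
exists S, (fun m => (m%:R : rat)%:A *: f m),
  (fun m => fps_mul (fps_deriv S) T m.-1); split.
- exact: lS.
- exact: Sl.
- move=> n; apply: etrans (fS n); apply: eq_bigr => k _; congr (_ *: _).
  apply: (@eq_fps_pow K _ _ _ n.+1) => // i _.
  rewrite /Phi_series; case: eqP => [->|/eqP i0]; first by rewrite f0.
  rewrite scalerA mulr_algl scalerA mulVf ?scale1r //.
  by rewrite Num.Theory.pnatr_eq0.
- move=> n; rewrite -[LHS](fps_mul1 (fps_deriv S)).
  by rewrite -(eq_fps_mul (frefl _) TS) fps_mulA.
Qed.

(* Main.v *)
From HB Require Import structures.
Require Import Defs.
From mathcomp Require Import all_boot all_order all_algebra.

Set Implicit Arguments.
Unset Strict Implicit.
Unset Printing Implicit Defensive.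

Import GRing.Theory.
Local Open Scope ring_scope.

(** For a single part n, both relations pass through the complete functions S.
  - Solving n S_n = \sum_k Xi_k S_(n-k), and expanding sigma = exp(Phi), gives
    the S_n as sums over the compositions J of n ([S_Xi], [S_Phi]):
      S_n = \sum_J Xi^J / pi_u(rev J) = \sum_J Phi^J / sp(J).
  - Conversely, Phi = log sigma and xi = sigma' sigma^-1 give Phi_n and Xi_n as
    signed sums over the compositions L of n ([Phi_S], [Xi_S]):
      Phi_n = - \sum_L (-1)^l(L) (n / l(L)) S^L,
      Xi_n = - \sum_L (-1)^l(L) fp(L) S^L.
  A product over the parts of I of sums over compositions of the parts is a sum
  over the refinements of I, because concatenation is a bijection from the
  tuples of compositions of the parts of I to the refinements of I
  ([prod_sum_refines]). Applying this first to I and then to each refinement L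
  of I produces the double sum over J finer than L finer than I
  ([relation_refines]); all the statistics are multiplicative over blocks, so
  the coefficients are the stated ones.

  The noncommutativity of the coefficients is harmless for Phi = log sigma: both
  sides are rational power series in the single element Phi(t), so that the
  identity log(exp X) = X of truncated rational polynomials
  ([coef_log_expm1_poly]) can be evaluated at Phi(t) ([fps_log_exp]). *)

(** * Refinements as families of blocks *)

Lemma flatten_comp (Js : seq (seq nat)) :
  Js != [::] -> all is_comp Js -> is_comp (flatten Js).
Proof.
case: Js => // J Js _ /= /andP[/andP[J0 Jgt0] JsP].
rewrite /is_comp; apply/andP; split; first by case: J J0 {Jgt0}.
rewrite all_cat Jgt0 /=; elim: Js JsP => //= B Js IH /andP[/andP[_ Bgt0] JsP].
by rewrite all_cat Bgt0 IH.
Qed.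

Lemma refines_sumn (J I : seq nat) : refines J I -> sumn J = sumn I.
Proof. by case/refinesP => Js [<- <- _]; rewrite sumn_flatten. Qed.

Lemma refines_comp (J I : seq nat) : refines J I -> is_comp I -> is_comp J.
Proof.
case/refinesP => Js [<- <- JsP] /andP[Js0 _]; apply: flatten_comp => //.
by case: Js Js0 {JsP}.
Qed.

(** The blocks of J over L are grouped according to the blocks of L over I, and
  each group is concatenated. *)
Lemma refines_trans (L J I : seq nat) :
  refines J L -> refines L I -> refines J I.
Proof.
case/refinesP => Js [<- defL JsP] /refinesP[Ls [defLs <- LsP]].
apply/refinesP; exists (map flatten (reshape (shape Ls) Js)).
have szJs : size Js = sumn (shape Ls).
  by rewrite -(size_map sumn) defL -defLs size_flatten.
have JsE : flatten (reshape (shape Ls) Js) = Js by rewrite reshapeKr ?szJs.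
have LsE : map (map sumn) (reshape (shape Ls) Js) = Ls.
  by rewrite map_reshape defL -defLs flattenK.
move: (reshape _ _) JsE LsE => Jss JsE LsE; split.
- by rewrite -JsE; elim: Jss {JsE LsE} => //= Bs Jss IH; rewrite IH flatten_cat.
- rewrite -map_comp -[in RHS]LsE -[RHS]map_comp; apply: eq_map => Bs /=.
  by rewrite sumn_flatten.
- move: JsP LsP; rewrite -JsE -LsE; elim: Jss {JsE LsE} => //= Bs Jss IH.
  rewrite all_cat => /andP[BsP JssP] /andP[/andP[Bs0 _] LsP].
  rewrite IH // andbT flatten_comp //.
  by case: Bs Bs0 {BsP}.
Qed.

Lemma blocks_rev (J L : seq nat) :
  refines J L -> blocks (rev J) (rev L) = rev (map rev (blocks J L)).
Proof.
case/refinesP => Js [<- <- JsP]; rewrite blocks_flatten //.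
have -> : rev (flatten Js) = flatten (rev (map rev Js)).
  elim: Js {JsP} => // B Js IH.
  by rewrite /= rev_cat IH rev_cons -cats1 flatten_cat /= cats0.
have -> : rev (map sumn Js) = map sumn (rev (map rev Js)).
  rewrite map_rev -map_comp; congr rev; apply: eq_map => B /=.
  by rewrite sumn_rev.
rewrite blocks_flatten // all_rev all_map; apply: sub_all JsP => B /=.
rewrite /is_comp all_rev => /andP[B0 ->]; rewrite andbT.
by rewrite -size_eq0 size_rev size_eq0.
Qed.

(** All ways to replace each part of I by a composition of it. *)
Fixpoint blockings (I : seq nat) : seq (seq (seq nat)) :=
  if I is i :: I' then
    [seq B :: Bs | B <- compositions i, Bs <- blockings I']
  else [:: [::]].

Lemma mem_blockings (I : seq nat) (Bs : seq (seq nat)) :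
  (Bs \in blockings I) = (map sumn Bs == I) && all is_comp Bs.
Proof.
elim: I Bs => [|i I IH] [|B Bs] //=.
  by apply/allpairsP => -[[? ?] []].
apply/allpairsP/idP => [[[B' Bs'] /= [BP BsP [-> ->]]]|].
  move: BP BsP; rewrite mem_compositions IH.
  by case/andP=> -> /eqP-> /andP[/eqP-> ->]; rewrite eqxx.
case/andP=> /eqP[iE IE] /andP[BP BsP]; exists (B, Bs).
by rewrite mem_compositions IH BP BsP iE IE !eqxx.
Qed.

Lemma blockings_uniq (I : seq nat) : uniq (blockings I).
Proof.
elim: I => //= i I IH; apply: allpairs_uniq => //; first exact: compositions_uniq.
by move=> [? ?] [? ?] _ _ [-> ->].
Qed.

(** Concatenation is injective on families of compositions with prescribed sums,
  since the blocks can be read off the concatenated sequence. *)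
Lemma perm_blockings (I : seq nat) : is_comp I ->
  perm_eq (blockings I)
    [seq blocks J I | J <- compositions (sumn I) & refines J I].
Proof.
move=> IP; apply: uniq_perm; first exact: blockings_uniq.
  rewrite map_inj_in_uniq; first by rewrite filter_uniq ?compositions_uniq.
  move=> J J'; rewrite !mem_filter => /andP[/and3P[/eqP JE _ _] _].
  by move=> /andP[/and3P[/eqP J'E _ _] _] eqB; rewrite -JE eqB J'E.
move=> Bs; rewrite mem_blockings; apply/andP/mapP => [[/eqP IE BsP]|].
  have ref : refines (flatten Bs) I by apply/refinesP; exists Bs.
  exists (flatten Bs); last by rewrite -IE blocks_flatten.
  by rewrite mem_filter ref mem_compositions (refines_comp ref IP)
    (refines_sumn ref) /=.
by case=> J; rewrite mem_filter => /andP[/and3P[_ ? ?] _] ->.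
Qed.

(** * Substitution of families indexed by compositions *)

Section Substitution.
Variables (K : comNzRingType) (A : algType K).

Lemma prod_sum_blockings (g : seq nat -> A) (I : seq nat) :
  \prod_(i <- I) \sum_(B <- compositions i) g B =
  \sum_(Bs <- blockings I) \prod_(B <- Bs) g B.
Proof.
elim: I => [|i I IH]; first by rewrite big_nil big_seq1 big_nil.
rewrite big_cons IH big_allpairs_dep mulr_suml; apply: eq_bigr => B _.
by rewrite mulr_sumr; apply: eq_bigr => Bs _; rewrite big_cons.
Qed.

(** Expanding the product chooses a composition of each part of I; the choices are
  then indexed by their concatenation L. *)
Lemma prod_sum_refines (F S : nat -> A) (b : seq nat -> K) (I : seq nat) :
    (forall n, (0 < n)%N ->
       F n = \sum_(L <- compositions n) b L *: \prod_(l <- L) S l) ->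
    is_comp I ->
  \prod_(i <- I) F i =
  \sum_(L <- compositions (sumn I) | refines L I)
    (\prod_(B <- blocks L I) b B) *: \prod_(l <- L) S l.
Proof.
move=> FE IP; pose g L := b L *: \prod_(l <- L) S l.
transitivity (\prod_(i <- I) \sum_(B <- compositions i) g B).
  apply: eq_big_seq => i iI; apply: FE.
  by case/andP: IP => _ /allP/(_ i iI).
rewrite prod_sum_blockings (perm_big _ (perm_blockings IP)) big_map big_filter.
apply: eq_bigr => L /and3P[/eqP LE _ _].
by rewrite scaler_prod -big_flatten LE.
Qed.

(** The expansion in S is followed by the expansion of each S^L in W; the sums are
  exchanged by transitivity of refinement. *)
Lemma prod_sum_refines2 (F S W : nat -> A) (b c : seq nat -> K) (I : seq nat) :
    (forall n, (0 < n)%N ->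
       F n = \sum_(L <- compositions n) b L *: \prod_(l <- L) S l) ->
    (forall n, (0 < n)%N ->
       S n = \sum_(J <- compositions n) c J *: \prod_(j <- J) W j) ->
    is_comp I ->
  \prod_(i <- I) F i =
  \sum_(J <- compositions (sumn I) | refines J I)
    (\sum_(L <- compositions (sumn I) | refines J L && refines L I)
       (\prod_(B <- blocks L I) b B) * (\prod_(B <- blocks J L) c B))
    *: \prod_(j <- J) W j.
Proof.
move=> FE SE IP; rewrite (prod_sum_refines FE IP).
transitivity (\sum_(L <- compositions (sumn I) | refines L I)
    \sum_(J <- compositions (sumn I) | refines J L)
      ((\prod_(B <- blocks L I) b B) * (\prod_(B <- blocks J L) c B))
      *: \prod_(j <- J) W j).
  apply: eq_bigr => L LI.
  rewrite (prod_sum_refines SE (refines_comp LI IP)) scaler_sumr.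
  by rewrite (refines_sumn LI); apply: eq_bigr => J _; rewrite scalerA.
rewrite (exchange_big_dep (fun J => refines J I)) /=; last first.
  by move=> L J LI JL; apply: refines_trans JL LI.
apply: eq_bigr => J JI; rewrite scaler_suml; apply: eq_bigl => L.
exact: andbC.
Qed.

End Substitution.

(** * Recursion on the first part *)

(** Compositions of n with the empty sequence allowed for n = 0, so that removing
  the first part never leaves the range of the sum. *)
Definition words (n : nat) : seq (seq nat) :=
  if n is 0 then [:: [::]] else compositions n.

Lemma mem_words (n : nat) (J : seq nat) :
  (J \in words n) = all (leq 1) J && (sumn J == n).
Proof.
case: n => [|n].
  by rewrite inE; case: J => [|[|i] J] //=; rewrite addSn andbF.
by rewrite mem_compositions /is_comp; case: J => [|i J] //=.
Qed.

Lemma words_uniq (n : nat) : uniq (words n).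
Proof. by case: n => // n; apply: compositions_uniq. Qed.

Lemma big_words (V : nmodType) (n : nat) (g : seq nat -> V) :
  \sum_(J <- words n.+1) g J =
  \sum_(i < n.+1) \sum_(J <- words (n - i)) g (i.+1 :: J).
Proof.
pose s := [seq i.+1 :: J | i <- index_iota 0 n.+1, J <- words (n - i)].
have -> : \sum_(J <- words n.+1) g J = \sum_(J <- s) g J.
  apply: perm_big; apply: uniq_perm; first exact: words_uniq.
    apply: allpairs_uniq_dep; first exact: iota_uniq.
      by move=> i _; apply: words_uniq.
    by move=> [i J] [k L] _ _ /= [-> ->].
  move=> J; rewrite mem_words; apply/andP/allpairsPdep => [[JP /eqP sJ]|].
    case: J JP sJ => [|[|i] J] //= JP [sJ]; exists i, J.
    by split; rewrite // ?mem_index_iota ?mem_words ?JP -?sJ ?addKn ?ltnS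
      ?leq_addr /=.
  case=> i [L []]; rewrite mem_index_iota mem_words ltnS /=.
  by move=> lein /andP[LP /eqP sL] ->; rewrite /= LP sL addSn subnKC.
by rewrite big_allpairs_dep big_mkord.
Qed.

(** The factors of [pi_u (rev J)] are the sums of the suffixes of J: this is the
  form in which the denominators arise when a recursion on the first part is
  unfolded. *)
Lemma pi_u_rev_cons (i : nat) (J : seq nat) :
  pi_u (rev (i :: J)) = ((i + sumn J) * pi_u (rev J))%N.
Proof.
rewrite /pi_u size_rev /= big_ord_recr /= mulnC; congr (_ * _)%N.
  by rewrite take_oversize ?size_rev // sumn_rev.
rewrite size_rev; apply: eq_bigr => k _; rewrite rev_cons -cats1 takel_cat //.
by rewrite size_rev.
Qed.

Lemma leq_size_words n J : J \in words n -> (size J <= n)%N.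
Proof.
rewrite mem_words => /andP[JP /eqP <-].
by elim: J JP => //= j J IH /andP[j0 /IH]; apply: (leq_add j0).
Qed.

Lemma sum_words_size (V : nmodType) n (G : nat -> seq nat -> V) :
  \sum_(k < n.+1) \sum_(J <- words n | size J == k) G k J =
  \sum_(J <- words n) G (size J) J.
Proof.
rewrite (exchange_big_dep xpredT) //=; apply: eq_big_seq => J JP.
have lt_Jn : (size J < n.+1)%N by rewrite ltnS leq_size_words.
by rewrite (big_pred1 (Ordinal lt_Jn)) // => k; rewrite eq_sym.
Qed.

Lemma prod_words n J (R : nzRingType) (f g : nat -> R) : J \in words n ->
    (forall j, (0 < j)%N -> f j = g j) ->
  \prod_(j <- J) f j = \prod_(j <- J) g j.
Proof.
rewrite mem_words => /andP[/allP JP _] fg.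
by apply: eq_big_seq => j /JP; apply: fg.
Qed.

(** * Powers of series without constant term *)

Section FpsPowers.
Variable A : nzRingType.
Implicit Type f : fps A.

(** Since f has no constant term, only products of coefficients of positive degree
  contribute to f^k. *)
Lemma fps_pow_words f k n : f 0%N = 0 ->
  fps_pow f k n = \sum_(J <- words n | size J == k) \prod_(j <- J) f j.
Proof.
move=> f0; elim: k n => [|k IHk] n.
  rewrite /= /fps1 (eq_bigl (pred1 [::])) => [|J]; last by rewrite size_eq0.
  have [->|n0] := eqVneq n 0%N; first by rewrite big_mkcond big_seq1 /= big_nil.
  rewrite big_seq_cond big1 // => J /andP[+ /eqP JE].
  by rewrite mem_words JE eq_sym (negPf n0).
change (fps_mul f (fps_pow f k) n =
  \sum_(J <- words n | size J == k.+1) \prod_(j <- J) f j).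
case: n => [|n].
  by rewrite /fps_mul big_ord1 f0 mul0r big_mkcond big_seq1.
rewrite /fps_mul big_ord_recl f0 mul0r add0r [RHS]big_mkcond big_words.
apply: eq_bigr => i _; rewrite lift0 subSS IHk mulr_sumr big_mkcond.
by apply: eq_bigr => J _; rewrite eqSS; case: ifP; rewrite // big_cons.
Qed.

Lemma fps_pow_small f k n : f 0%N = 0 -> (n < k)%N -> fps_pow f k n = 0.
Proof.
move=> f0 lt_nk; rewrite fps_pow_words // big_seq_cond big1 // => J.
by case/andP=> /leq_size_words szJ /eqP Jk; rewrite Jk leqNgt lt_nk in szJ.
Qed.

Lemma coef_exp_fps f (p : {poly A}) N k n :
    (forall i, (i <= N)%N -> p`_i = f i) -> (n <= N)%N ->
  (p ^+ k)`_n = fps_pow f k n.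
Proof.
move=> pf; elim: k n => [|k IHk] n nN.
  by rewrite expr0 coef1.
rewrite exprS coefM; apply: eq_bigr => i _.
rewrite pf ?IHk //; first by apply: leq_trans nN; apply: leq_subr.
by apply: leq_trans nN; rewrite -ltnS.
Qed.

End FpsPowers.

(** * The logarithm of the exponential *)

Section LogExpPoly.
Variable N : nat.

(** exp(X) - 1, truncated after degree N. *)
Definition expm1_poly : {poly rat} :=
  \sum_(i < N) i.+1`!%:R^-1 *: 'X^(i.+1).

(** log(1 + Y), truncated after degree N, at Y = [expm1_poly]. *)
Definition log_expm1_poly : {poly rat} :=
  \sum_(k < N) ((-1) ^+ k / k.+1%:R) *: expm1_poly ^+ k.+1.

Local Notation E := expm1_poly.

Lemma deriv_expm1_poly : E^`() = 1 + E - N`!%:R^-1 *: 'X^N.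
Proof.
have -> : 1 + E = \sum_(i < N.+1) i`!%:R^-1 *: 'X^i.
  by rewrite big_ord_recl fact0 invr1 scale1r.
rewrite big_ord_recr /= addrK /E raddf_sum; apply: eq_bigr => i _ /=.
rewrite derivZ derivXn /= -scaler_nat scalerA; congr (_ *: _).
by rewrite factS natrM invfM mulrAC mulVf ?mul1r // Num.Theory.pnatr_eq0.
Qed.

Lemma dvdX_expm1_poly : 'X %| E.
Proof.
apply: (big_ind (fun p => 'X %| p)) => [|p q|i _]; first exact: dvdp0.
  exact: dvdp_add.
by rewrite exprS scalerAr dvdp_mulr.
Qed.

Lemma deriv_log_expm1_poly : log_expm1_poly^`() = E^`() * \sum_(k < N) (- E) ^+ k.
Proof.
rewrite raddf_sum mulr_sumr; apply: eq_bigr => k _ /=.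
rewrite derivZ deriv_exp /= -scaler_nat scalerA.
rewrite divfK ?Num.Theory.pnatr_eq0 // scalerAr; congr (_ * _).
by rewrite -[- E]scaleN1r exprZn.
Qed.

(** With l for [log_expm1_poly] and E for [expm1_poly]: modulo X^N, E' = 1 + E,
  and l'/E' is a geometric sum of ratio -E, with E^N = 0; hence
  (1 + E) l' = 1 + E. As 1 + E is invertible modulo X^N, l' = 1 modulo X^N. *)
Lemma coef_log_expm1_poly m : (m <= N)%N ->
  log_expm1_poly`_m = (m == 1%N)%:R.
Proof.
have dvdXN (p : {poly rat}) : 'X^N %| p * (- E) ^+ N.
  by rewrite dvdp_mull // dvdp_exp2r // dvdpNr dvdX_expm1_poly.
have dl : 'X^N %| log_expm1_poly^`() - 1.
  have cop : coprimep 'X^N (1 + E).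
    rewrite coprimep_expl // coprimep_sym coprimepX.
    rewrite /root hornerD hornerC.
    have /dvdpP[q ->] := dvdX_expm1_poly.
    by rewrite hornerM hornerX mulr0 addr0 oner_eq0.
  rewrite -(Gauss_dvdpr _ cop).
  have geo : (1 + E) * \sum_(k < N) (- E) ^+ k = 1 - (- E) ^+ N.
    rewrite -[1 - _]opprB subrX1 -mulNr opprB opprK //.
  have -> : (1 + E) * (log_expm1_poly^`() - 1) =
     - ((1 + E) * (- E) ^+ N) - N`!%:R^-1 *: ((1 - (- E) ^+ N) * 'X^N).
    rewrite deriv_log_expm1_poly mulrBr mulrCA geo deriv_expm1_poly mulr1.
    rewrite mulrBl mulrBr mulr1 -scalerAl ['X^N * _]mulrC.
    by rewrite addrAC [1 + E - _ - _]addrAC subrr add0r.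
  apply: dvdp_sub; first by rewrite dvdpNr dvdXN.
  by rewrite scalerAl dvdp_mull.
case: m => [|m] mN.
  rewrite coef_sum big1 // => k _; rewrite coefZ exprS.
  have /dvdpP[q ->] := dvdX_expm1_poly.
  by rewrite [q * 'X * _]mulrAC coefMX mulr0.
have /dvdpP[q /eqP] := dl; rewrite subr_eq => /eqP /(congr1 (coefp m)) /=.
rewrite coef_deriv coefD coefMXn mN add0r coef1 eqSS => lE.
apply: (mulIf (_ : m.+1%:R != 0)); first by rewrite Num.Theory.pnatr_eq0.
rewrite mulr_natr lE; by case: m {mN lE} => // m; rewrite mul0r.
Qed.

End LogExpPoly.

Section Relations.
Variables (K : comAlgType rat) (A : algType K).

Local Notation "q %:AK" := ((q : rat)%:A : K) (at level 2).

(** The polynomial identity is evaluated at the truncation P of f, by the ring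
  morphism from {poly rat} to {poly A} sending X to P. It exists because rational
  scalars are central. *)
Lemma fps_log_exp (f s : fps A) n : f 0%N = 0 -> fps_exp f =1 s -> (0 < n)%N ->
  f n = \sum_(k < n) ((-1) ^+ k / k.+1%:R)%:AK *:
          fps_pow (fun m => if m == 0%N then 0 else s m) k.+1 n.
Proof.
move=> f0 fs n0; pose P : {poly A} := \poly_(i < n.+1) f i.
have PE i : (i <= n)%N -> P`_i = f i by rewrite coef_poly ltnS => ->.
pose phi : {rmorphism rat -> {poly A}} :=
  polyC \o (GRing.in_alg A \o GRing.in_alg K).
have phiM q (p : {poly A}) i : (phi q * p)`_i = q%:AK *: p`_i.
  by rewrite coefCM /= mulr_algl.
have cP : commr_rmorph phi P.
  by move=> q; apply/polyP => i; rewrite phiM coefMC /= mulr_algr.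
pose ev : {rmorphism {poly rat} -> {poly A}} := horner_morph cP.
have evZ q p : ev (q *: p) = phi q * ev p.
  by rewrite -mul_polyC rmorphM /= horner_morphC.
have evE i : (i <= n)%N ->
    (ev (expm1_poly n))`_i = if i == 0%N then 0 else s i.
  move=> le_in; rewrite raddf_sum coef_sum /=.
  transitivity (\sum_(k < n) (k.+1`!%:R^-1)%:AK *: fps_pow f k.+1 i).
    apply: eq_bigr => k _; rewrite evZ phiM rmorphXn /= horner_morphX.
    by rewrite (coef_exp_fps _ PE).
  case: eqP => [->|/eqP i0].
    by rewrite big1 // => k _; rewrite fps_pow_small ?scaler0.
  rewrite -fs /fps_exp big_ord_recl [fps_pow f ord0 i]/(fps1 A i) /fps1.
  rewrite (negPf i0) scaler0 add0r.
  rewrite (@big_ord_widen _ _ _ i n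
    (fun k => (k.+1`!%:R^-1)%:AK *: fps_pow f k.+1 i)) //.
  rewrite [RHS]big_mkcond; apply: eq_bigr => k _; case: ltnP => // ik.
  by rewrite fps_pow_small ?scaler0.
(* P has no constant term, so multiples of X^(n+1) evaluate to polynomials
   without terms of degree at most n. *)
have dvdXl : 'X^(n.+1) %| 'X - log_expm1_poly n.
  apply/dvdpP; exists (drop_poly n.+1 ('X - log_expm1_poly n)).
  rewrite -[LHS](poly_take_drop n.+1) [take_poly _ _](_ : _ = 0) ?add0r //.
  apply/polyP => i; rewrite coef_take_poly coef0 ltnS; case: ifP => // le_in.
  by rewrite coefB coefX coef_log_expm1_poly // subrr.
have /dvdpP[q /eqP] := dvdXl; rewrite subr_eq => /eqP /(congr1 ev).
rewrite rmorphD /= rmorphM rmorphXn /= horner_morphX => /(congr1 (coefp n)) /=.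
rewrite PE // coefD coefM big1 ?add0r => [->|i _]; last first.
  by rewrite [(P ^+ _)`__](coef_exp_fps _ PE) ?leq_subr // fps_pow_small ?mulr0 //
    ltnS leq_subr.
rewrite raddf_sum coef_sum; apply: eq_bigr => k _ /=.
by rewrite evZ phiM rmorphXn /= (coef_exp_fps _ evE).
Qed.

(** * The families S, Phi and Xi *)

Variables S Phi Xi : nat -> A.

Lemma scaleAKA (a b : rat) (x : A) : a%:AK *: (b%:AK *: x) = (a * b)%:AK *: x.
Proof. by rewrite scalerA mulr_algl scalerA. Qed.

Lemma mulrn_AK n (x : A) : x *+ n = n%:R%:AK *: x.
Proof. by rewrite !scaler_nat. Qed.

Lemma S_Xi :
    S 0%N = 1 -> fps_deriv S =1 fps_mul (fun m => Xi m.+1) S ->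
  forall n, S n =
    \sum_(J <- words n) ((pi_u (rev J))%:R^-1)%:AK *: \prod_(j <- J) Xi j.
Proof.
move=> S0 dS; elim/ltn_ind => -[|n] IHn.
  by rewrite S0 big_seq1 /pi_u big_ord0 big_nil invr1 !scale1r.
have n1 : n.+1%:R != 0 :> rat by rewrite Num.Theory.pnatr_eq0.
have -> : S n.+1 = (n.+1%:R^-1)%:AK *: fps_mul (fun m => Xi m.+1) S n.
  rewrite -dS /fps_deriv mulrn_AK.
  by rewrite scaleAKA mulVf // !scale1r.
rewrite big_words scaler_sumr; apply: eq_bigr => i _.
rewrite IHn ?ltnS ?leq_subr // mulr_sumr scaler_sumr.
apply: eq_big_seq => J; rewrite mem_words => /andP[_ /eqP sJ].
rewrite -scalerAr scaleAKA big_cons pi_u_rev_cons sJ addSn subnKC -1?ltnS //.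
by rewrite natrM invfM.
Qed.

Section Exp.
Hypothesis exp_Phi :
  fps_exp (fun m => if m == 0%N then 0 else (m%:R^-1)%:AK *: Phi m) =1 S.

Lemma S_0 : S 0%N = 1.
Proof. by rewrite -exp_Phi /fps_exp big_ord1 /= /fps1 fact0 invr1 !scale1r. Qed.

(** The terms of exp(Phi(t)) of degree n: the k-th power collects the compositions
  of length k, k! and the denominators of Phi(t) making up sp(J). *)
Lemma S_Phi n :
  S n = \sum_(J <- words n) ((sp J)%:R^-1)%:AK *: \prod_(j <- J) Phi j.
Proof.
transitivity (\sum_(k < n.+1) \sum_(J <- words n | size J == k)
    (k`!%:R^-1)%:AK *: (((pi_comp J)%:R^-1)%:AK *: \prod_(j <- J) Phi j)).
  rewrite -exp_Phi; apply: eq_bigr => k _.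
  rewrite fps_pow_words // scaler_sumr big_seq_cond [RHS]big_seq_cond.
  apply: eq_bigr => J /andP[JP _]; congr (_ *: _).
  rewrite (prod_words JP (g := fun j => (j%:R^-1)%:AK *: Phi j)); last by case.
  rewrite scaler_prod -[X in X *: _](rmorph_prod (GRing.in_alg K)).
  by rewrite prodfV natr_prod.
rewrite (sum_words_size n (fun k J =>
  (k`!%:R^-1)%:AK *: (((pi_comp J)%:R^-1)%:AK *: \prod_(j <- J) Phi j))).
apply: eq_bigr => J _.
by rewrite scaleAKA /sp natrM invfM.
Qed.

(** The coefficient of t^n in log(sigma(t)), whose k-th term (sigma - 1)^k collects
  the compositions of length k. *)
Lemma Phi_S n : (0 < n)%N ->
  Phi n = \sum_(L <- compositions n)
    (- ((-1) ^+ size L * ((sumn L)%:R / (size L)%:R)))%:AK *: \prod_(l <- L) S l.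
Proof.
move=> n0; have nn0 : n%:R != 0 :> rat by rewrite Num.Theory.pnatr_eq0 -lt0n.
have -> : Phi n = n%:R%:AK *: ((n%:R^-1)%:AK *: Phi n).
  by rewrite scaleAKA mulfV // !scale1r.
have := fps_log_exp (erefl _) exp_Phi n0.
rewrite [X in X = _]/= eqn0Ngt n0 [X in X = _]/= => ->.
transitivity (n%:R%:AK *: \sum_(k < n.+1) \sum_(L <- words n | size L == k)
   ((- (-1) ^+ k) / k%:R)%:AK *: \prod_(l <- L) S l).
  (* The term k = 0 vanishes, by the convention 0^-1 = 0 in rat. *)
  congr (_ *: _); rewrite [RHS]big_ord_recl.
  rewrite [X in _ = X + _]big1 => [|L _]; last first.
    by rewrite /= invr0 mulr0 !scale0r.
  rewrite add0r; apply: eq_bigr => k _; rewrite lift0 exprS mulN1r opprK.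
  rewrite -scaler_sumr; congr (_ *: _).
  rewrite fps_pow_words // big_seq_cond [RHS]big_seq_cond.
  by apply: eq_bigr => L /andP[LP _]; apply: (prod_words LP); case.
rewrite (sum_words_size n (fun k L =>
  ((- (-1) ^+ k) / k%:R)%:AK *: \prod_(l <- L) S l)).
rewrite scaler_sumr; case: (n) n0 => // m _.
apply: eq_big_seq => L; rewrite mem_compositions => /andP[_ /eqP ->].
by rewrite scaleAKA; congr (_%:AK *: _); rewrite mulNr mulrN mulrCA.
Qed.

End Exp.

(** T(t) = 1 / sigma(t): the coefficients follow from the recursion
  T_n = - \sum_(0 < i <= n) S_i T_(n-i). *)
Lemma inv_S (T : fps A) : S 0%N = 1 -> fps_mul S T =1 fps1 A ->
  forall n, T n = \sum_(L <- words n) ((-1) ^+ size L)%:AK *: \prod_(l <- L) S l.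
Proof.
move=> S0 ST; elim/ltn_ind => -[|n] IHn.
  move: (ST 0%N); rewrite /fps_mul big_ord1 S0 mul1r => ->.
  by rewrite big_seq1 big_nil !scale1r.
move: (ST n.+1); rewrite /fps_mul big_ord_recl S0 mul1r subn0 => /eqP.
rewrite addr_eq0 => /eqP ->; rewrite big_words -sumrN; apply: eq_bigr => i _.
rewrite lift0 subSS IHn ?ltnS ?leq_subr // mulr_sumr -sumrN.
apply: eq_bigr => L _; rewrite big_cons -scalerAr /= exprS mulN1r.
by rewrite !scaleNr.
Qed.

(** In xi = sigma' sigma^-1, the part of L contributed by sigma' is the first one,
  with the factor fp(L) coming from the derivative. *)
Lemma Xi_S (T : fps A) : S 0%N = 1 -> fps_mul S T =1 fps1 A ->
    fps_deriv S =1 fps_mul (fun m => Xi m.+1) S ->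
  forall n, (0 < n)%N -> Xi n = \sum_(L <- compositions n)
    (- ((-1) ^+ size L * (fp L)%:R))%:AK *: \prod_(l <- L) S l.
Proof.
move=> S0 ST dS [//|n] _.
have -> : Xi n.+1 = fps_mul (fps_deriv S) T n.
  rewrite (eq_fps_mul dS (frefl T)) -fps_mulA.
  by rewrite (eq_fps_mul (frefl _) ST) fps_mul1.
rewrite -[compositions _]/(words n.+1) big_words; apply: eq_bigr => i _.
rewrite (inv_S S0 ST) mulr_sumr; apply: eq_bigr => L _.
rewrite big_cons /fps_deriv -scalerAr mulrnAl mulrn_AK.
rewrite scaleAKA; congr (_%:AK *: _).
by rewrite /= exprS mulN1r mulNr opprK mulrC.
Qed.

(** * The double sum over refinements *)

Lemma prod_sign_blocks (b : seq nat -> rat) (L I : seq nat) : refines L I ->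
  \prod_(B <- blocks L I) - ((-1) ^+ size B * b B) =
  (-1) ^+ size I * ((-1) ^+ size L * \prod_(B <- blocks L I) b B).
Proof.
case/refinesP => Ls [<- <- LsP]; rewrite blocks_flatten // size_map.
elim: Ls {LsP} => [|B Ls IH]; first by rewrite !big_nil !mul1r.
rewrite !big_cons IH /= size_cat exprD exprS [X in _ = _ * X]mulrACA !mulNr mul1r.
by congr (- _); apply: mulrCA.
Qed.

(** The signs - (-1)^l(L_a) of the blocks L_a of L over I multiply to
  (-1)^l(I) (-1)^l(L), whose first factor comes out of the sum. *)
Lemma relation_refines (F G W : nat -> A) (b c : seq nat -> rat) I :
    (forall n, (0 < n)%N -> F n =
       \sum_(L <- compositions n)
         (- ((-1) ^+ size L * b L))%:AK *: \prod_(l <- L) G l) ->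
    (forall n, (0 < n)%N ->
       G n = \sum_(J <- compositions n) (c J)%:AK *: \prod_(j <- J) W j) ->
    is_comp I ->
  \prod_(i <- I) F i =
  (-1) ^+ size I *
  \sum_(J <- compositions (sumn I) | refines J I)
    (\sum_(L <- compositions (sumn I) | refines J L && refines L I)
       (-1) ^+ size L *
       (\prod_(B <- blocks L I) b B * \prod_(B <- blocks J L) c B))%:AK
    *: \prod_(j <- J) W j.
Proof.
move=> FE GE IP; rewrite (prod_sum_refines2 FE GE IP) mulr_sumr.
apply: eq_bigr => J _.
rewrite -[(-1) ^+ size I](rmorph_sign (GRing.in_alg A)) mulr_algl scalerA.
congr (_ *: _).
rewrite -[X in X * _](rmorph_sign (GRing.in_alg K)) /= mulr_algl scalerA.
rewrite mulr_sumr -[RHS]in_algE rmorph_sum.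
apply: eq_bigr => L /andP[_ LI]; rewrite -!(rmorph_prod (GRing.in_alg K)).
rewrite -[LHS](rmorphM (GRing.in_alg K)) prod_sign_blocks //.
by congr (_%:AK); rewrite -!mulrA.
Qed.

End Relations.

(** * NSym as an algebra *)

Section MalgAlgebra.
Variables (M : monomType) (R : comNzRingType).

Fact malg_scaleAr (c : R) (x y : {malg R[M]}) : c *: (x * y) = x * (c *: y).
Proof.
apply/malgP => k; rewrite mcoeffZ.
rewrite !(@mcoeffMlw _ _ (msupp x) (msupp y)) ?fsubset_refl ?msuppZ_le //.
rewrite mulr_sumr; apply: eq_bigr => k1 _; rewrite mulr_sumr.
by apply: eq_bigr => k2 _; rewrite mcoeffZ mulrCA mulrnAr.
Qed.

End MalgAlgebra.

(** An alias of NSym that carries the algebra structure given by [malg_scaleAr];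
  NSym is not commutative, unlike the monoid algebras of commutative monoids
  whose algebra structure is attached to malg itself. *)
Definition NSymA (K : comAlgType rat) : Type := NSym K.

Section NSymAlgebra.
Variable K : comAlgType rat.
HB.instance Definition _ := GRing.Lalgebra.copy (NSymA K) (NSym K).
HB.instance Definition _ :=
  GRing.Lalgebra_isAlgebra.Build K (NSymA K) (@malg_scaleAr _ K).
End NSymAlgebra.

(** * The two relations *)

Section Coefficients.
Variables (J L I : seq nat).
Hypotheses (JL : refines J L) (LI : refines L I).

(** Reversing J and L reverses the list of blocks and each block in it. *)
Lemma coef_Phi_Xi :
  (-1) ^+ size L *
    (\prod_(B <- blocks L I) ((sumn B)%:R / (size B)%:R) *
     \prod_(B <- blocks J L) (pi_u (rev B))%:R^-1) =
  (-1) ^+ size L * (pi_comp I)%:R /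
    ((relprod pi_u (rev J) (rev L))%:R * (relprod size L I)%:R) :> rat.
Proof.
have /and3P[_ /eqP IE _] := LI.
rewrite /relprod blocks_rev // (perm_big _ (permEl (perm_rev _))) big_map /=.
rewrite -[in X in X%:R]IE /pi_comp big_map !natr_prod big_split /= !prodfV.
by rewrite invfM -!mulrA; congr (_ * (_ * _)); rewrite mulrC.
Qed.

Lemma coef_Xi_Phi :
  (-1) ^+ size L *
    (\prod_(B <- blocks L I) (fp B)%:R * \prod_(B <- blocks J L) (sp B)%:R^-1) =
  (-1) ^+ size L * (relprod fp L I)%:R / (relprod sp J L)%:R :> rat.
Proof. by rewrite /relprod !natr_prod prodfV mulrA. Qed.

End Coefficients.

Unset Implicit Arguments.

Theorem mainTheorem12 (K : comAlgType rat) (S Phi Xi : nat -> NSym K)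
  (lambda_sigma :
     fps_mul (fps_mirror (lambda_series K)) (sigma_series S) =1 fps1 (NSym K))
  (sigma_lambda :
     fps_mul (sigma_series S) (fps_mirror (lambda_series K)) =1 fps1 (NSym K))
  (exp_Phi : fps_exp (Phi_series Phi) =1 sigma_series S)
  (deriv_sigma :
     fps_deriv (sigma_series S) =1 fps_mul (xi_series Xi) (sigma_series S))
  (I : seq nat) (compI : is_comp I) :
  wpow Phi I =
    (-1) ^+ size I *
    (\sum_(J <- compositions (sumn I) | refines J I)
       (\sum_(L <- compositions (sumn I) | refines J L && refines L I)
          ((-1) ^+ size L * (pi_comp I)%:R /
           ((relprod pi_u (rev J) (rev L))%:R * (relprod size L I)%:R)
           : rat))%:A *: wpow Xi J)
  /\
  wpow Xi I =
    (-1) ^+ size I *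
    (\sum_(J <- compositions (sumn I) | refines J I)
       (\sum_(L <- compositions (sumn I) | refines J L && refines L I)
          ((-1) ^+ size L * (relprod fp L I)%:R / (relprod sp J L)%:R
           : rat))%:A *: wpow Phi J).
Proof.
pose A := NSymA K.
have S0 : S 0%N = 1 by apply: (@S_0 K A S Phi exp_Phi).
have SPhi n : (0 < n)%N -> S n = \sum_(J <- compositions n)
    ((sp J)%:R^-1 : rat)%:A *: wpow Phi J.
  by case: n => // n _; apply: (@S_Phi K A S Phi exp_Phi).
have SXi n : (0 < n)%N -> S n = \sum_(J <- compositions n)
    ((pi_u (rev J))%:R^-1 : rat)%:A *: wpow Xi J.
  by case: n => // n _; apply: (@S_Xi K A S Xi S0 deriv_sigma).
split.
  apply: etrans (@relation_refines K A Phi S Xi _ _ I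
    (@Phi_S K A S Phi exp_Phi) SXi compI) _.
  congr (_ * _); apply: eq_bigr => J _; congr (_%:A *: _).
  by apply: eq_bigr => L /andP[JL LI]; apply: coef_Phi_Xi.
apply: etrans (@relation_refines K A Xi S Phi _ _ I
  (@Xi_S K A S Xi _ S0 sigma_lambda deriv_sigma) SPhi compI) _.
congr (_ * _); apply: eq_bigr => J _; congr (_%:A *: _).
by apply: eq_bigr => L /andP[JL LI]; apply: coef_Xi_Phi.
Qed.
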